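(* Fix an integer $s>1$ and set $q=2^s$. There exists $\alpha\in\mathcal{T}_q$ of height $\frac{1}{q+1}$ and gonality $2$.
   Context: $\mathbb{F}_q(T)$ is the rational function field over the field with $q$ elements, $\overline{\mathbb{F}_q(T)}$ a fixed algebraic closure, and $\mathbb{F}_q((T))$ the field of formal Laurent series. The minimal polynomial of $\alpha\in\overline{\mathbb{F}_q(T)}$ is the unique polynomial $f\in\mathbb{F}_q[T][x]$ that is irreducible over $\mathbb{F}_q(T)$ as a polynomial in $x$, satisfies $f(\alpha)=0$, has coefficients in $\mathbb{F}_q[T]$ with no common factor, and whose leading coefficient (in $x$) is a monic polynomial in $T$. The height is $h(\alpha)=\deg_T(f)/\deg_x(f)$. An element $\alpha$ is totally $T$-adic if its minimal polynomial splits completely over $\mathbb{F}_q((T))$; $\mathcal{T}_q$ denotes the set of all totally $T$-adic elements of $\overline{\mathbb{F}_q(T)}$. The gonality of a curve $X/\mathbb{F}_q$ is the minimum degree of a nonconstant $\mathbb{F}_q$-morphism $X\to\mathbb{P}^1$; the gonality of $\alpha$ is the gonality of the smooth proper curve over $\mathbb{F}_q$ with function field $\mathbb{F}_q(T,\alpha)$. *)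

(* Defs.v *)
From HB Require Import structures.
From mathcomp Require Import all_boot all_order all_algebra.
From mathcomp Require Import boolp classical_sets.

Set Implicit Arguments.
Unset Strict Implicit.
Unset Printing Implicit Defensive.

Import GRing.Theory.
Local Open Scope classical_set_scope.
Local Open Scope ring_scope.

(* The integral domain F[[T]].  A series is its sequence of coefficients; the
   wrapper keeps the Cauchy product apart from the pointwise product on
   nat -> F. *)

Record powser (F : Type) := PowSer { pscoef :> nat -> F }.
Arguments PowSer {F} _.

Section PowSer.
Variable F : fieldType.
Implicit Types f g h : powser F.

HB.instance Definition _ := gen_eqMixin (powser F).
HB.instance Definition _ := gen_choiceMixin (powser F).

Lemma powserP f g : f =1 g -> f = g.
Proof. by case: f g => [f] [g] /= e; congr PowSer; apply/funext. Qed.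

Definition ps_zero : powser F := PowSer (fun=> 0).
Definition ps_opp f : powser F := PowSer (fun n => - f n).
Definition ps_add f g : powser F := PowSer (fun n => f n + g n).
Definition ps_one : powser F := PowSer (fun n => (n == 0%N)%:R).
Definition ps_mul f g : powser F :=
  PowSer (fun n => \sum_(i < n.+1) f i * g (n - i)%N).

Fact ps_addA : associative ps_add.
Proof. by move=> f g h; apply: powserP => n /=; rewrite addrA. Qed.
Fact ps_addC : commutative ps_add.
Proof. by move=> f g; apply: powserP => n /=; rewrite addrC. Qed.
Fact ps_add0 : left_id ps_zero ps_add.
Proof. by move=> f; apply: powserP => n /=; rewrite add0r. Qed.
Fact ps_addN : left_inverse ps_zero ps_opp ps_add.
Proof. by move=> f; apply: powserP => n /=; rewrite addNr. Qed.

HB.instance Definition _ :=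
  GRing.isZmodule.Build (powser F) ps_addA ps_addC ps_add0 ps_addN.

Let trunc n f : {poly F} := \poly_(i < n) f i.

Let coef_trunc n f i : (i < n)%N -> (trunc n f)`_i = f i.
Proof. by move=> lt_in; rewrite coef_poly lt_in. Qed.

Let ps_mulE n m f g (p q : {poly F}) : (n < m)%N ->
  (forall i, (i < m)%N -> p`_i = f i) ->
  (forall i, (i < m)%N -> q`_i = g i) -> (p * q)`_n = ps_mul f g n.
Proof.
move=> lt_nm pf qg; rewrite coefM /=; apply: eq_bigr => i _.
rewrite pf ?qg ?(leq_ltn_trans (leq_subr _ _) lt_nm) //.
by apply: leq_trans lt_nm; rewrite ltnS -ltnS ltn_ord.
Qed.

Fact ps_mulA : associative ps_mul.
Proof.
move=> f g h; apply: powserP => n; have lt_n := ltnSn n.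
have tM (a b : powser F) i : (i < n.+1)%N ->
  (trunc n.+1 a * trunc n.+1 b)`_i = ps_mul a b i.
  by move=> lt_i; apply: (ps_mulE lt_i) => j; apply: coef_trunc.
have tc (a : powser F) i : (i < n.+1)%N -> (trunc n.+1 a)`_i = a i.
  exact: coef_trunc.
rewrite -(ps_mulE lt_n (tc f) (tM g h)) -(ps_mulE lt_n (tM f g) (tc h)).
by rewrite mulrA.
Qed.

Fact ps_mulC : commutative ps_mul.
Proof.
move=> f g; apply: powserP => n; have lt_n := ltnSn n.
have tc (a : powser F) i : (i < n.+1)%N -> (trunc n.+1 a)`_i = a i.
  exact: coef_trunc.
by rewrite -(ps_mulE lt_n (tc f) (tc g)) mulrC (ps_mulE lt_n (tc g) (tc f)).
Qed.

Fact ps_mul1 : left_id ps_one ps_mul.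
Proof.
move=> f; apply: powserP => n /=.
by rewrite big_ord_recl /= subn0 mul1r big1 ?addr0 // => i _; rewrite mul0r.
Qed.

Fact ps_mulDl : left_distributive ps_mul ps_add.
Proof.
move=> f g h; apply: powserP => n /=.
by rewrite -big_split /=; apply: eq_bigr => i _; rewrite mulrDl.
Qed.

Fact ps_one_neq0 : ps_one != 0.
Proof.
apply/eqP => /(congr1 (fun f : powser F => f 0%N)) /= /eqP.
by rewrite oner_eq0.
Qed.

HB.instance Definition _ := GRing.Zmodule_isComNzRing.Build (powser F)
  ps_mulA ps_mulC ps_mul1 ps_mulDl ps_one_neq0.

Definition ps_unit : {pred powser F} := fun f => `[< exists g, g * f = 1 >].
Definition ps_inv f : powser F :=
  if pselect (exists g, g * f = 1) is left e then projT1 (cid e) else f.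

Fact ps_mulV : {in ps_unit, left_inverse 1 ps_inv *%R}.
Proof.
move=> f /asboolP uf; rewrite /ps_inv.
by case: pselect => // e; case: (cid e).
Qed.
Fact ps_unitPl f g : g * f = 1 -> ps_unit f.
Proof. by move=> gf1; apply/asboolP; exists g. Qed.
Fact ps_inv_out : {in [predC ps_unit], ps_inv =1 id}.
Proof.
move=> f /negP uf; rewrite /ps_inv; case: pselect => // e.
by case: uf; apply/asboolP.
Qed.

HB.instance Definition _ :=
  GRing.ComNzRing_hasMulInverse.Build (powser F) ps_mulV ps_unitPl ps_inv_out.

Let ps_order f : f != 0 ->
  exists2 m, f m != 0 & forall i, (i < m)%N -> f i = 0.
Proof.
move=> nz_f; have /ex_minnP[m fm min_m] : exists m, f m != 0.
  apply: contrapT => fN; case/eqP: nz_f; apply: powserP => n /=.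
  by apply/eqP/negP => fn; case: fN; exists n; apply/negP.
exists m => // i lt_im; apply/eqP; apply: contraTT lt_im => /min_m.
by rewrite -leqNgt.
Qed.

Fact ps_idomain : GRing.integral_domain_axiom (powser F).
Proof.
move=> f g fg0; apply: contraT; rewrite negb_or => /andP[/ps_order[m fm f0]].
case/ps_order=> k gk g0; case/eqP: (mulf_neq0 fm gk).
have <- : ps_mul f g (m + k)%N = 0 by rewrite -[ps_mul f g]/(f * g) fg0.
rewrite /=.
have lt_m : (m < (m + k).+1)%N by rewrite ltnS leq_addr.
rewrite (bigD1 (Ordinal lt_m)) //= addKn big1 ?addr0 // => i ne_im.
case: (ltngtP i m) => [/f0-> | lt_mi | eq_im]; first by rewrite mul0r.
  by rewrite g0 ?mulr0 // ltn_subLR ?ltn_add2r // -ltnS ltn_ord.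
by case/eqP: ne_im; apply: val_inj.
Qed.

HB.instance Definition _ :=
  GRing.ComUnitRing_isIntegral.Build (powser F) ps_idomain.

Definition powser_of_poly (p : {poly F}) : powser F := PowSer (fun n => p`_n).

Fact powser_of_poly_is_zmod_morphism : zmod_morphism powser_of_poly.
Proof. by move=> p q; apply: powserP => n /=; rewrite coefB. Qed.
Fact powser_of_poly_is_monoid_morphism : monoid_morphism powser_of_poly.
Proof.
split; first by apply: powserP => n /=; rewrite coef1.
by move=> p q; apply: powserP => n /=; rewrite coefM.
Qed.

HB.instance Definition _ := GRing.isZmodMorphism.Build {poly F} (powser F)
  powser_of_poly powser_of_poly_is_zmod_morphism.
HB.instance Definition _ := GRing.isMonoidMorphism.Build {poly F} (powser F)
  powser_of_poly powser_of_poly_is_monoid_morphism.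

End PowSer.

Notation laurent F := {fraction (powser F)}.

Definition laurent_of_poly (F : fieldType) (p : {poly F}) : laurent F :=
  FracField.tofrac (powser_of_poly p).

Notation ratfun F := {fraction {poly F}}.

(* Elements of F[T][x] have type {poly {poly F}}: the outer variable is x and
   sizeY measures the degree in the inner variable T. *)

Section TotallyTadic.
Variables (F : fieldType) (Kbar : fieldType).
Variable iota : {rmorphism ratfun F -> Kbar}.
Implicit Types (f : {poly {poly F}}) (alpha : Kbar).

Definition is_minimal_polynomial alpha f : Prop :=
  [/\ irreducible_poly (map_poly (@FracField.tofrac {poly F}) f),
      root (map_poly (iota \o @FracField.tofrac {poly F}) f) alpha,
      forall d : {poly F}, (forall i, d %| f`_i) -> size d = 1%N
    & lead_coef f \is monic].

Definition deg_x f : nat := (size f).-1.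
Definition deg_T f : nat := (sizeY f).-1.

Definition has_height alpha (h : rat) : Prop :=
  exists2 f, is_minimal_polynomial alpha f & h = (deg_T f)%:R / (deg_x f)%:R.

Definition splits_completely (L : fieldType) (p : {poly L}) : Prop :=
  exists rs : seq L, p = lead_coef p *: \prod_(r <- rs) ('X - r%:P).

Definition totally_Tadic : set Kbar := [set alpha |
  exists2 f, is_minimal_polynomial alpha f
           & splits_completely (map_poly (@laurent_of_poly F) f)].

End TotallyTadic.

Section Degree.
Variable L : fieldType.
Implicit Types A K E : set L.

Definition is_subfield K : Prop :=
  [/\ K 1, forall x y, K x -> K y -> K (x - y)
    & forall x y, K x -> K y -> K (x / y)].

Definition generated_subfield A : set L :=
  [set x | forall K, is_subfield K -> A `<=` K -> K x].

(* [K : E] = d, for subfields E `<=` K of L: K has an E-basis with d elements. *)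
Definition has_degree K E (d : nat) : Prop :=
  exists2 b : 'rV[L]_d, (forall i, K (b 0 i)) &
    forall x, K x -> exists! c : 'rV[L]_d,
      (forall i, E (c 0 i)) /\ x = \sum_i c 0 i * b 0 i.

End Degree.

Section Gonality.
Variables (F : fieldType) (Kbar : fieldType).
Variable iota : {rmorphism ratfun F -> Kbar}.

Definition const_emb : F -> Kbar :=
  iota \o @FracField.tofrac {poly F} \o polyC.

(* Let X be the smooth proper curve over F with function field K.  Pulling back
   the coordinate function of P^1 identifies the nonconstant F-morphisms
   X -> P^1 with the g in K that are transcendental over F, and the degree of
   the morphism is that of the extension of function fields K / F(g). *)
Definition has_map_to_P1 (K : set Kbar) (d : nat) : Prop :=
  exists g : Kbar, [/\ K g, ~ algebraicOver const_emb g
    & has_degree K (generated_subfield (range const_emb `|` [set g])) d].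

Definition curve_gonality (K : set Kbar) (d : nat) : Prop :=
  has_map_to_P1 K d /\ forall e, has_map_to_P1 K e -> (d <= e)%N.

Definition has_gonality (alpha : Kbar) (d : nat) : Prop :=
  curve_gonality (generated_subfield (range iota `|` [set alpha])) d.

End Gonality.

(* Main.v *)
Require Import Defs.
From HB Require Import structures.
From mathcomp Require Import all_boot all_order all_algebra.
From mathcomp Require Import generic_quotient finfield.
From mathcomp Require Import boolp classical_sets.
From mathcomp Require Import zify ring.

Set Implicit Arguments.
Unset Strict Implicit.
Unset Printing Implicit Defensive.

Import GRing.Theory.
Local Open Scope ring_scope.

(** Let q = #|F| > 3 and choose u in F with u <> 0 and u^2 <> 1.  Put
    P = x^q - x, D = 1 + x P, b = u + u^-1 and
      f(x, T) = (D^2 + P) T^2 + b P D T + P^2.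
    It has degree 2(q + 1) in x and degree 2 in T; the element alpha is any
    root of f in Kbar.  With w = P / T the equation f = 0 reads
    w^2 + b D w + D^2 + P = 0, that is, (w + u D) (w + u^-1 D) = - P: the
    function field of alpha is a quadratic extension of F(x).

    Total splitting.  P vanishes to order one at each of the q rational values
    of x, and D is 1 there; the same holds at infinity once f is made
    homogeneous of degree 2(q + 1).  So x = a + T z turns f into T^2 times a
    polynomial in z that reduces modulo T to z^2 - b z + 1 =
    (z - u) (z - u^-1), and x = (- T z)^-1 does the same.  The two roots are
    distinct because u^2 <> 1, and Hensel's lemma lifts them: f has 2(q + 1)
    distinct roots in F((T)) ([laurent_points], [laurent_splits]).

    All points are alike.  Call a root r of f in a field containing F(T) a
    generic point.  It is transcendental over F, and T is not a rational
    function of it, since a rational w would have to be a polynomial in x, and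
    comparing degrees in (w + u D) (w + u^-1 D) = - P excludes that
    ([curve_no_section]).  Division by f, as a quadratic polynomial in T, then
    shows that a polynomial relation between r and T holds at one generic point
    exactly when it holds at every other ([generic_transfer]).  In particular a
    factor of f that has a root in Kbar vanishes at the 2(q + 1) roots in
    F((T)), so f is irreducible over F(T) ([curve_poly_irreducible]), and its
    height is 2 / (2 (q + 1)).

    Gonality.  The function x has degree 2 ([degree2_map]).  If the function
    field were F(g), the 2(q + 1) points in F((T)) would give as many distinct
    values of g in F((T)), all of them solutions of T = N(g) / M(g) with N and
    M coprime polynomials over F.  Where such a value is integral, its residue is a simple zero of
    N and determines the value, so at most q of the values are integral; the
    same bound for g^-1 leaves room for only 2 q points ([not_rational]).  This
    says that a rational curve does not have 2(q + 1) rational points. *)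

(** * Power series and Hensel's lemma *)

Section PowerSeries.
Variable F : fieldType.
Implicit Types f g : powser F.

Definition psC (c : F) : powser F := powser_of_poly c%:P.
HB.instance Definition _ :=
  GRing.RMorphism.copy psC (@powser_of_poly F \o polyC).

Arguments psC : simpl never.

Definition psT : powser F := powser_of_poly 'X.

Definition ps0 f : F := f 0%N.

Arguments ps0 : simpl never.

Fact ps0_is_zmod_morphism : zmod_morphism ps0.
Proof. by []. Qed.
Fact ps0_is_monoid_morphism : monoid_morphism ps0.
Proof.
by split=> // f g; rewrite [LHS]big_ord_recl big_ord0 addr0.
Qed.
HB.instance Definition _ :=
  GRing.isZmodMorphism.Build (powser F) F ps0 ps0_is_zmod_morphism.
HB.instance Definition _ :=
  GRing.isMonoidMorphism.Build (powser F) F ps0 ps0_is_monoid_morphism.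

Lemma psCK : cancel psC ps0.
Proof. by move=> c; rewrite [LHS]coefC. Qed.

Lemma ps0T : ps0 psT = 0.
Proof. by rewrite [LHS]coefX. Qed.

Lemma powser_of_poly_inj : injective (@powser_of_poly F).
Proof. by move=> p q e; apply/polyP => i; apply: (congr1 (fun f => pscoef f i) e). Qed.

Lemma psT_neq0 : psT != 0.
Proof.
apply/eqP => /(congr1 (fun f => pscoef f 1)) /eqP.
by rewrite /= coefX oner_eq0.
Qed.

Lemma psM f g n : (f * g) n = \sum_(i < n.+1) f i * g (n - i)%N.
Proof. by []. Qed.

Lemma psTM f n : (psT * f) n = if n is m.+1 then f m else 0.
Proof.
rewrite psM.
case: n => [|n]; first by rewrite big_ord_recl big_ord0 addr0 /= coefX mul0r.
rewrite big_ord_recl /= coefX mul0r add0r.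
rewrite big_ord_recl /= coefX mul1r /bump /= subSS subn0.
by rewrite big1 ?addr0 // => i _; rewrite coefX mul0r.
Qed.

Lemma psT_dvdP f : ps0 f = 0 -> exists g, f = psT * g.
Proof.
move=> f0; exists (PowSer (fun n => f n.+1)); apply: powserP => n.
by rewrite psTM; case: n.
Qed.

Lemma psTX_dvdP f n :
  (forall i, (i < n)%N -> f i = 0) <-> exists g, f = psT ^+ n * g.
Proof.
split; last first.
  case=> g ->; elim: n => [|n IHn] // [|i] lt_in; first by rewrite exprS -mulrA psTM.
  by rewrite exprS -mulrA psTM IHn.
elim: n f => [|n IHn] f f0; first by exists f; rewrite mul1r.
have [g Df] := psT_dvdP (f0 0%N isT).
have [i lt_in|h Dg] := IHn g; last by exists h; rewrite Df Dg exprS mulrA.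
by have := f0 i.+1 lt_in; rewrite Df psTM.
Qed.

Lemma poly_taylor1 (R : comNzRingType) (p : {poly R}) x h :
  exists r, p.[x + h] = p.[x] + p^`().[x] * h + r * h ^+ 2.
Proof.
elim/poly_ind: p => [|p c [r IHp]].
  by exists 0; rewrite deriv0 !horner0 !mul0r !addr0.
exists (r * (x + h) + p^`().[x]).
by rewrite derivMXaddC !(hornerMXaddC, hornerD, hornerMX) IHp; ring.
Qed.

(** Newton iteration with the slope frozen at the residue u: the derivative
    stays constant modulo T, so each step multiplies the error by a series
    divisible by T. *)
Theorem hensel (p : {poly powser F}) (u : F) :
  root (map_poly ps0 p) u -> ~~ root (map_poly ps0 p)^`() u ->
  exists2 z, ps0 z = u & p.[z] = 0.
Proof.
have red r : (map_poly ps0 r).[u] = ps0 r.[psC u].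
  by rewrite -[in LHS](psCK u) horner_map.
rewrite deriv_map !rootE !red => /eqP pu0 dpu.
set k := psC (ps0 p^`().[psC u])^-1.
pose z := fix z n := if n is m.+1 then z m - k * p.[z m] else psC u.
have zS n : z n.+1 = z n - k * p.[z n] by [].
have invz n : ps0 (z n) = u /\ exists g, p.[z n] = psT ^+ n.+1 * g.
  elim: n => [|n [zn_u [g Dg]]]; rewrite ?zS.
    by rewrite psCK expr1; split=> //; apply: psT_dvdP.
  split.
    by rewrite rmorphB !rmorphM /= Dg exprS !rmorphM /= ps0T zn_u; ring.
  have [r ->] := poly_taylor1 p (z n) (- (k * p.[z n])).
  have [h Dh] : exists h, 1 - k * p^`().[z n] = psT * h.
    apply: psT_dvdP; rewrite rmorphB rmorphM rmorph1 /= psCK.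
    by rewrite -[ps0 _.[z n]]horner_map /= zn_u red mulVf ?subrr.
  exists (h * g + r * k ^+ 2 * psT ^+ n * g ^+ 2).
  rewrite (_ : _ + _ = p.[z n] * (1 - k * p^`().[z n]) + r * (k * p.[z n]) ^+ 2);
    last by ring.
  by rewrite Dh Dg !exprS; ring.
have stab n m i : (n <= m)%N -> (i < n.+1)%N -> z m i = z n i.
  move=> le_nm lt_in; rewrite -(subnK le_nm); elim: (m - n)%N => // d IHd.
  rewrite -{}IHd addSn zS; have [_ [g ->]] := invz (d + n)%N.
  set e := k * _; have: exists h, e = psT ^+ (d + n).+1 * h.
    by exists (k * g); rewrite /e; ring.
  rewrite -addnS => /(psTX_dvdP e _).2/(_ i (leq_trans lt_in (leq_addl d n.+1))) e0.
  by rewrite -[LHS]/(z (d + n)%N i - e i) e0 subr0.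
(* The n-th coefficient is constant from the n-th iterate on. *)
pose y : powser F := PowSer (fun n => z n n).
exists y; first by rewrite -(invz 0%N).1.
apply: powserP => n.
have [|h Dh] := (psTX_dvdP (y - z n) n.+1).1.
  move=> i lt_in; rewrite -[LHS]/(z i i - z n i).
  by rewrite (stab i n) ?subrr.
have [_ [g Dg]] := invz n.
have [r] := poly_taylor1 p (z n) (y - z n).
rewrite addrC subrK => ->; rewrite Dg Dh.
have : exists e, psT ^+ n.+1 * g + p^`().[z n] * (psT ^+ n.+1 * h)
           + r * (psT ^+ n.+1 * h) ^+ 2 = psT ^+ n.+1 * e.
  by exists (g + p^`().[z n] * h + r * psT ^+ n.+1 * h ^+ 2); ring.
by move=> /psTX_dvdP/(_ n (ltnSn n)).
Qed.

(** By Taylor's formula p(z') - p(z) is z' - z times a series with the residue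
    of p'(z), which is a unit. *)
Theorem hensel_unique (p : {poly powser F}) z z' :
    ~~ root (map_poly ps0 p)^`() (ps0 z) ->
  ps0 z = ps0 z' -> p.[z] = 0 -> p.[z'] = 0 -> z = z'.
Proof.
rewrite deriv_map rootE horner_map /= => dpz ezz' pz pz'.
have [r] := poly_taylor1 p z (z' - z).
rewrite addrC subrK pz pz' => e.
have: (z' - z) * (p^`().[z] + r * (z' - z)) = 0.
  by apply: etrans (esym e); ring.
move/eqP; rewrite mulf_eq0 subr_eq0 => /orP[/eqP-> // | /eqP/(congr1 ps0)].
rewrite rmorphD rmorphM rmorphB rmorph0 /= ezz' subrr mulr0 addr0 => e0.
by rewrite e0 eqxx in dpz.
Qed.

Lemma ps_invertible f : ps0 f != 0 -> exists g, f * g = 1.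
Proof.
move=> f0; have [||g _ /eqP] := @hensel (f *: 'X - 1) (ps0 f)^-1.
- by rewrite rmorphB rmorph1 /= map_polyZ /= map_polyX rootE !hornerE divff ?subrr.
- rewrite rmorphB rmorph1 /= map_polyZ /= map_polyX derivB derivZ derivX derivC.
  by rewrite subr0 rootE hornerZ hornerC mulr1.
by rewrite hornerD hornerN hornerZ hornerX hornerC subr_eq0 => /eqP; exists g.
Qed.

Lemma ps_valuation f : f != 0 -> exists n g, ps0 g != 0 /\ f = psT ^+ n * g.
Proof.
move=> f_neq0; have /ex_minnP[m fm min_m] : exists m, f m != 0.
  apply: contrapT => fN; case/eqP: f_neq0; apply: powserP => n.
  by apply/eqP/negP => fn; case: fN; exists n; apply/negP.
have [|g Dg] := (psTX_dvdP f m).1.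
  by move=> i lt_im; apply/eqP; apply: contraTT lt_im => /min_m; rewrite -leqNgt.
exists m, g; split=> //; apply: contraNneq fm => g0.
have [h Dh] := psT_dvdP g0.
apply/eqP; apply: (psTX_dvdP f m.+1).2 (ltnSn m).
by exists h; rewrite Dg Dh exprSr mulrA.
Qed.

(** F[[T]] is a valuation ring: this is what makes every Laurent series
    integral or the inverse of an integral one. *)
Lemma ps_total_dvd f g : (exists h, f = g * h) \/ (exists h, g = f * h).
Proof.
have [->|/ps_valuation[m [f1 [/ps_invertible[f1' Vf] Df]]]] := eqVneq f 0.
  by left; exists 0; rewrite mulr0.
have [->|/ps_valuation[n [g1 [/ps_invertible[g1' Vg] Dg]]]] := eqVneq g 0.
  by right; exists 0; rewrite mulr0.
have [le_nm|/ltnW le_mn] := leqP n m; [left|right].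
  exists (psT ^+ (m - n) * f1 * g1').
  rewrite Df Dg -{1}(subnK le_nm) exprD -[in LHS](mulr1 f1) -Vg; ring.
exists (psT ^+ (n - m) * g1 * f1').
rewrite Df Dg -{1}(subnK le_mn) exprD -[in LHS](mulr1 g1) -Vf; ring.
Qed.

End PowerSeries.
Arguments ps0 {F} f : simpl never.
Arguments psC {F} c : simpl never.
Arguments psT F : simpl never.

(** * The curve and its generic points *)

(** Homogenization: a polynomial N in a quotient U / V becomes, after
    multiplication by a power of V, an element of R that depends only on N, U
    and V.  Relations between quotients can thus be moved from one field to
    another along relations in R. *)
Lemma fraction_horner (F : fieldType) (R : comNzRingType) (k : {rmorphism F -> R})
    (N : {poly F}) (U V : R) : exists n W, forall (M : fieldType) (e : {rmorphism R -> M}),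
  e V != 0 -> e W = e V ^+ n * (map_poly (e \o k) N).[e U / e V].
Proof.
elim/poly_ind: N => [|N c [n [W DW]]].
  by exists 0%N, 0 => M e _; rewrite !rmorph0 horner0 mulr0.
exists n.+1, (W * U + k c * V ^+ n.+1) => M e eV.
rewrite !(rmorphE, rmorphM) /= map_polyX map_polyC hornerMXaddC /= DW // exprS.
by field.
Qed.

Section Curve.
Variables (F : fieldType) (q : nat) (u : F).
Hypotheses (q_gt1 : (1 < q)%N) (u_neq0 : u != 0) (u2_neq1 : u ^+ 2 != 1).

Definition curve_eq (R : comNzRingType) (b t x : R) : R :=
  let P := x ^+ q - x in let D := 1 + x * P in
  (D ^+ 2 + P) * t ^+ 2 + b * P * D * t + P ^+ 2.

Lemma rmorph_curve_eq (R S : comNzRingType) (h : {rmorphism R -> S}) b t x :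
  h (curve_eq b t x) = curve_eq (h b) (h t) (h x).
Proof. by rewrite /curve_eq !(rmorphE, rmorphM). Qed.

(** These constants are locked so that rewriting with the morphism lemmas stops
    at them instead of expanding them. *)
Definition utrace : F := locked (u + u^-1).
Definition Px : {poly F} := locked ('X^q - 'X).
Definition Dx : {poly F} := locked (1 + 'X * Px).

Lemma utraceE : utrace = u + u^-1. Proof. by rewrite /utrace -lock. Qed.
Lemma PxE : Px = 'X^q - 'X. Proof. by rewrite /Px -lock. Qed.
Lemma DxE : Dx = 1 + 'X * Px. Proof. by rewrite /Dx -lock. Qed.

(** The outer variable is x, the inner one is T. *)
Definition curve_poly : {poly {poly F}} := locked (curve_eq utrace%:P%:P 'X%:P 'X).
Lemma curve_polyE : curve_poly = curve_eq utrace%:P%:P 'X%:P 'X.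
Proof. by rewrite /curve_poly -lock. Qed.

Lemma size_Px : size Px = q.+1.
Proof. by rewrite PxE size_polyDl ?size_polyXn // size_polyN size_polyX ltnS. Qed.

Lemma Px_neq0 : Px != 0.
Proof. by rewrite -size_poly_eq0 size_Px. Qed.

Lemma size_Dx : size Dx = q.+2.
Proof.
rewrite DxE addrC size_polyDl ?size_poly1 mulrC size_mulX ?Px_neq0 // size_Px //.
Qed.

Lemma Dx_neq0 : Dx != 0.
Proof. by rewrite -size_poly_eq0 size_Dx. Qed.

Lemma u_subV_neq0 : u - u^-1 != 0.
Proof.
apply: contra u2_neq1; rewrite subr_eq0 => /eqP e.
by rewrite expr2 {2}e mulfV.
Qed.

(** The quadratic equation of the curve has no solution w / n in F(x).  In lowest
    terms w / n is integral over F[x], so n is a constant; then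
    (w + u D n) (w + u^-1 D n) = - P n^2 has degree q, while the two factors
    differ by a nonzero multiple of D, of degree q + 1, so one of them has
    degree at least q + 1, and both are nonzero. *)
Lemma curve_no_section (w n : {poly F}) :
  w ^+ 2 + utrace%:P * Dx * w * n + (Dx ^+ 2 + Px) * n ^+ 2 = 0 -> n = 0.
Proof.
move=> e; apply/eqP/negPn/negP => n_neq0.
have wn : (w != 0) || (n != 0) by rewrite n_neq0 orbT.
have := coprimep_div_gcd wn; set d := gcdp w n.
have d_neq0 : d != 0 by rewrite gcdp_eq0 negb_and.
have := divpK (dvdp_gcdl w n); have := divpK (dvdp_gcdr w n); rewrite -/d.
move: (w %/ d) (n %/ d) => w1 n1 Dn Dw co_w1n1.
have n1_neq0 : n1 != 0 by apply: contraNneq n_neq0 => n10; rewrite -Dn n10 mul0r.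
have {}e : w1 ^+ 2 + utrace%:P * Dx * w1 * n1 + (Dx ^+ 2 + Px) * n1 ^+ 2 = 0.
  apply: (mulfI (expf_neq0 2 d_neq0)); rewrite mulr0 -[RHS]e -Dn -Dw; ring.
(* n1 divides w1 ^+ 2 and is prime to w1. *)
have [c c_neq0 Dn1] : exists2 c, c != 0 & n1 = c%:P.
  apply/size_poly1P; rewrite -coprimepp; apply: (@coprimep_dvdl _ (w1 ^+ 2)).
    apply/dvdpP; exists (- (utrace%:P * Dx * w1 + (Dx ^+ 2 + Px) * n1)).
    by apply/eqP; rewrite -subr_eq0 -[X in _ == X]e; apply/eqP; ring.
  by rewrite coprimep_expr // coprimep_sym.
pose a := w1 + u%:P * Dx * n1; pose b := w1 + u^-1%:P * Dx * n1.
have uV : u%:P * u^-1%:P = 1 :> {poly F} by rewrite -polyCM mulfV.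
have Dab : a * b = - (Px * n1 ^+ 2).
  apply/eqP; rewrite -subr_eq0 -[X in _ == X]e; apply/eqP.
  rewrite /a /b utraceE polyCD.
  transitivity (w1 ^+ 2 + (u%:P + u^-1%:P) * Dx * w1 * n1
    + (u%:P * u^-1%:P) * Dx ^+ 2 * n1 ^+ 2 + Px * n1 ^+ 2); first by ring.
  by rewrite uV; ring.
have ab_neq0 : a * b != 0.
  by rewrite Dab oppr_eq0 mulf_neq0 ?Px_neq0 ?expf_neq0.
have [a_neq0 b_neq0] : a != 0 /\ b != 0 by apply/andP; rewrite -negb_or -mulf_eq0.
have size_ab : (size a + size b)%N = q.+2.
  have := size_mul a_neq0 b_neq0; rewrite Dab size_polyN.
  rewrite Dn1 -polyC_exp mulrC size_Cmul ?expf_neq0 // size_Px.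
  by move=> ->; rewrite prednK // addn_gt0 size_poly_gt0 a_neq0.
have size_amb : size (a - b) = q.+2.
  have -> : a - b = ((u - u^-1) * c)%:P * Dx.
    by rewrite polyCM polyCB -Dn1 /a /b; ring.
  by rewrite size_Cmul ?size_Dx // mulf_neq0 ?u_subV_neq0.
have := size_polyD a (- b); rewrite size_polyN size_amb -size_ab leq_max.
rewrite -{1}[X in (_ <= X)%N || _]addn0 leq_add2l leqn0 size_poly_eq0.
by rewrite (negPf b_neq0) -[X in (_ <= X)%N]add0n leq_add2r leqn0 size_poly_eq0 (negPf a_neq0).
Qed.

Lemma curve_poly_coefs : curve_poly = map_poly polyC (Dx ^+ 2 + Px) * 'X%:P ^+ 2
  + map_poly polyC (utrace%:P * Px * Dx) * 'X%:P + map_poly polyC (Px ^+ 2).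
Proof.
rewrite curve_polyE /curve_eq DxE PxE.
by rewrite !(rmorphE, rmorphM) /= map_polyX !map_polyC.
Qed.

Section GenericPoint.
Variables (M : fieldType) (h : {rmorphism {poly F} -> M}) (r : M).

Definition ev (G : {poly {poly F}}) : M := (map_poly h G).[r].
HB.instance Definition _ := GRing.RMorphism.copy ev (horner_eval r \o map_poly h).

(** Injectivity of h says that M contains F and that the image of T is
    transcendental over it; r is then a point of the curve above T. *)
Definition generic_point : Prop := injective h /\ ev curve_poly = 0.

Lemma evX : ev 'X = r. Proof. by rewrite /ev map_polyX hornerX. Qed.
Lemma evC p : ev p%:P = h p. Proof. by rewrite /ev map_polyC hornerC. Qed.

Lemma evP (p : {poly F}) : ev (map_poly polyC p) = (map_poly (h \o polyC) p).[r].
Proof. by rewrite /ev -map_poly_comp. Qed.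

Lemma horner_constX (p : {poly F}) : (map_poly (h \o polyC) p).[h 'X] = h p.
Proof.
by rewrite (map_poly_comp h) horner_map /= -/(comp_poly _ _) comp_polyXr.
Qed.

Lemma ev_curve_poly : ev curve_poly = curve_eq (h utrace%:P) (h 'X) r.
Proof.
by rewrite curve_polyE; move: utrace => b; rewrite (rmorph_curve_eq ev) /= !evC evX.
Qed.

Lemma ev_curve_poly_coefs : ev curve_poly = ev (map_poly polyC (Dx ^+ 2 + Px)) * h 'X ^+ 2
  + ev (map_poly polyC (utrace%:P * Px * Dx)) * h 'X + ev (map_poly polyC (Px ^+ 2)).
Proof.
rewrite curve_poly_coefs; move: (Dx ^+ 2 + Px) (utrace%:P * Px * Dx) (Px ^+ 2) => a b c.
by rewrite !(rmorphE, rmorphM) /= evC.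
Qed.

Let Pr : M := ev (map_poly polyC Px).
Let Dr : M := ev (map_poly polyC Dx).

Hypothesis gp : generic_point.

Let eT : (Dr ^+ 2 + Pr) * h 'X ^+ 2 + h utrace%:P * Pr * Dr * h 'X + Pr ^+ 2 = 0.
Proof.
rewrite -gp.2 ev_curve_poly_coefs.
by rewrite !(rmorphE, rmorphM) /= map_polyC !evC.
Qed.

Let PD : Dr = 1 + r * Pr.
Proof. by rewrite /Dr DxE !(rmorphE, rmorphM) /= map_polyX evX. Qed.

Lemma hX_transcendental : ~ algebraicOver (h \o polyC) (h 'X).
Proof.
case=> p p_neq0; rewrite rootE horner_constX => /eqP hp0.
by case/eqP: p_neq0; apply: gp.1; rewrite hp0 rmorph0.
Qed.

(** If r were algebraic over F, then so would be T, as a root of the quadratic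
    polynomial f(r, .).  That polynomial is nonzero: its constant coefficient
    is P(r)^2, and where P(r) = 0 its leading coefficient is 1. *)
Lemma generic_transcendental : ~ algebraicOver (h \o polyC) r.
Proof.
move=> alg_r; apply: hX_transcendental.
have algD := @algebraic_add _ _ (h \o polyC : {rmorphism F -> M}).
have algM := @algebraic_mul _ _ (h \o polyC : {rmorphism F -> M}).
have alg1 := algebraic1 (h \o polyC : {rmorphism F -> M}).
have algX n x : algebraicOver (h \o polyC) x -> algebraicOver (h \o polyC) (x ^+ n).
  by move=> alg_x; elim: n => // n IHn; rewrite exprS; apply: algM.
have algP : algebraicOver (h \o polyC) Pr.
  rewrite /Pr PxE !(rmorphE, rmorphM) /= map_polyX evX.
  by apply: algebraic_sub => //; apply: algX.
have algDr : algebraicOver (h \o polyC) Dr.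
  by rewrite PD; apply: algD => //; apply: algM.
pose p := Poly [:: Pr ^+ 2; h utrace%:P * Pr * Dr; Dr ^+ 2 + Pr].
apply/integral_algebraic; apply: (@integral_root _ _ _ p).
- apply/eqP => p0.
  have := coef_Poly [:: Pr ^+ 2; h utrace%:P * Pr * Dr; Dr ^+ 2 + Pr].
  rewrite -/p p0 => c; have := c 0%N; have := c 2; rewrite !coef0 /=.
  move=> A0 /esym/eqP; rewrite expf_eq0 /= => /eqP P0.
  by move/esym/eqP: A0; rewrite PD P0 mulr0 !addr0 expr1n oner_eq0.
- by rewrite rootE horner_Poly /=; apply/eqP; rewrite -[RHS]eT; ring.
apply/integral_poly => i; apply/integral_algebraic; rewrite coef_Poly.
case: i => [|[|[|i]]] /=; first exact: algX.
- by apply: (algM) => //; apply: (algM) => //; apply: (algebraic_id (h \o polyC)).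
- by apply: algD => //; apply: algX.
by rewrite nth_nil; apply: (algebraic0 (h \o polyC)).
Qed.

Lemma ev_inj_x (p : {poly F}) : ev (map_poly polyC p) = 0 -> p = 0.
Proof.
move=> p0; apply/eqP/negPn/negP => p_neq0.
by apply: generic_transcendental; exists p => //; rewrite rootE -evP p0.
Qed.

(** A relation r1 T + r0 = 0 gives the solution w / n = - P r1 / r0 of the
    quadratic equation of the curve at the point r, hence in F(x) since r is
    transcendental. *)
Lemma T_not_rational (r1 r0 : {poly F}) :
  ev (map_poly polyC r1) * h 'X + ev (map_poly polyC r0) = 0 -> r1 = 0 /\ r0 = 0.
Proof.
move=> e.
have: (- (Px * r1)) ^+ 2 + utrace%:P * Dx * (- (Px * r1)) * r0
        + (Dx ^+ 2 + Px) * r0 ^+ 2 = 0.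
  apply: ev_inj_x; rewrite !(rmorphE, rmorphM) /= map_polyC evC -/Pr -/Dr.
  set e1 := ev (map_poly _ r1) in e *; set e0 := ev (map_poly _ r0) in e *.
  (* Division of the quadratic equation of T by the linear one. *)
  transitivity (e1 ^+ 2 * ((Dr ^+ 2 + Pr) * h 'X ^+ 2 + h utrace%:P * Pr * Dr * h 'X + Pr ^+ 2)
   - (e1 * h 'X + e0) * ((Dr ^+ 2 + Pr) * e1 * h 'X + h utrace%:P * Pr * Dr * e1
       - (Dr ^+ 2 + Pr) * e0)); first by ring.
  by rewrite eT e mulr0 mul0r subrr.
move/[dup]=> /curve_no_section -> /eqP.
rewrite mulr0 addr0 expr0n mulr0 addr0 sqrf_eq0 oppr_eq0 mulf_eq0.
by rewrite (negPf Px_neq0) => /eqP.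
Qed.

End GenericPoint.
Arguments generic_point {M} h r.

Lemma lead_curve_neq0 : Dx ^+ 2 + Px != 0.
Proof.
apply/eqP => A0; have := @curve_no_section 0 1.
rewrite A0 expr0n !mulr0 !mul0r !addr0 => /(_ erefl)/eqP.
by rewrite oner_eq0.
Qed.

Lemma swapXY_curve_poly : swapXY curve_poly = (Dx ^+ 2 + Px)%:P * 'X^2
  + ((utrace%:P * Px * Dx)%:P * 'X + (Px ^+ 2)%:P).
Proof.
rewrite curve_poly_coefs; move: (Dx ^+ 2 + Px) (utrace%:P * Px * Dx) (Px ^+ 2) => a b c.
by rewrite !(rmorphE, rmorphM) /= !swapXY_map_polyC swapXY_Y addrA.
Qed.

Lemma swapXY_curve_poly_size_lead :
  size (swapXY curve_poly) = 3 /\ lead_coef (swapXY curve_poly) = Dx ^+ 2 + Px.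
Proof.
rewrite swapXY_curve_poly; have A0 := lead_curve_neq0.
have sA : size ((Dx ^+ 2 + Px)%:P * 'X^2) = 3 by rewrite size_Cmul // size_polyXn.
set B := (X in _ + X).
have sB : (size B < 3)%N.
  by rewrite size_MXaddC; case: ifP => // _; rewrite !ltnS size_polyC leq_b1.
rewrite size_polyDl ?lead_coefDl ?sA //; split=> //.
by rewrite lead_coefM lead_coefC lead_coefXn mulr1.
Qed.

(** Pseudo-division by f as a polynomial in T; the factor e, a power of the
    leading coefficient, involves x only and so vanishes at no generic point. *)
Lemma curve_reduction (G : {poly {poly F}}) : exists e K r1 r0, [/\ e != 0 &
  map_poly polyC e * G
    = K * curve_poly + (map_poly polyC r1 * 'X%:P + map_poly polyC r0)].
Proof.
have [sf lf] := swapXY_curve_poly_size_lead.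
have := Pdiv.Idomain.divp_eq (swapXY G) (swapXY curve_poly).
have f0 : swapXY curve_poly != 0 by rewrite -size_poly_gt0 sf.
have := Pdiv.Idomain.ltn_modpN0 (swapXY G) f0; rewrite sf lf ltnS.
have := expf_neq0 (scalp (swapXY G) (swapXY curve_poly)) lead_curve_neq0.
move: (_ ^+ scalp _ _) => e e_neq0; move: (_ %% _) (_ %/ _) => R K sR /(congr1 swapXY).
rewrite -mul_polyC rmorphD 2!rmorphM /= !swapXYK swapXY_polyC => De.
exists e, (swapXY K), R`_1, R`_0; split=> //.
rewrite De; congr (_ + _).
have {1}-> : R = (R`_1)%:P * 'X + (R`_0)%:P.
  apply/polyP => -[|[|i]]; rewrite coefD coefC coefMX coefC /= ?add0r ?addr0 //.
  by rewrite nth_default // (leq_trans sR).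
by rewrite rmorphD rmorphM /= !swapXY_polyC swapXY_X.
Qed.

(** Modulo f every polynomial is linear in T up to a factor in x, and a linear
    polynomial in T vanishes at a generic point only if it is zero. *)
Theorem generic_transfer (M1 M2 : fieldType) (h1 : {rmorphism {poly F} -> M1})
    (h2 : {rmorphism {poly F} -> M2}) r1 r2 (G : {poly {poly F}}) :
  generic_point h1 r1 -> generic_point h2 r2 -> ev h1 r1 G = 0 -> ev h2 r2 G = 0.
Proof.
move=> gp1 gp2 G0; have [e [K [a1 [a0 [e_neq0 De]]]]] := curve_reduction G.
have := congr1 (ev h1 r1) De.
rewrite !(rmorphE, rmorphM) /= G0 gp1.2 evC !mulr0 add0r => /esym.
case/(T_not_rational gp1) => a1_0 a0_0.
have := congr1 (ev h2 r2) De.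
rewrite a1_0 a0_0 !(rmorphE, rmorphM) /= gp2.2 mulr0 mul0r !addr0.
move/eqP; rewrite mulf_eq0 => /orP[/eqP/(ev_inj_x gp2)|/eqP //] e0.
by rewrite e0 eqxx in e_neq0.
Qed.

Section Transfer.
Variables (M1 M2 : fieldType).
Variables (h1 : {rmorphism {poly F} -> M1}) (h2 : {rmorphism {poly F} -> M2}).
Variables (r1 : M1) (r2 : M2).
Hypotheses (gp1 : generic_point h1 r1) (gp2 : generic_point h2 r2).

Lemma generic_neq0 G : ev h1 r1 G != 0 -> ev h2 r2 G != 0.
Proof.
by apply: contraNneq => G0; apply/eqP; apply: (generic_transfer gp2 gp1).
Qed.

Lemma map_ev_const (M : fieldType) (h : {rmorphism {poly F} -> M}) r (N : {poly F}) :
  map_poly (ev h r \o (polyC \o polyC)) N = map_poly (h \o polyC) N.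
Proof. by apply: eq_map_poly => c; rewrite /= evC. Qed.

(** If a function G of the curve is a rational function N / D of the function
    U / V at one generic point, then it is so at every other one. *)
Lemma transfer_parameter (U V G : {poly {poly F}}) (N D : {poly F}) :
    let g1 := ev h1 r1 U / ev h1 r1 V in let g2 := ev h2 r2 U / ev h2 r2 V in
    ev h1 r1 V != 0 -> (map_poly (h1 \o polyC) D).[g1] != 0 ->
    ev h1 r1 G = (map_poly (h1 \o polyC) N).[g1] / (map_poly (h1 \o polyC) D).[g1] ->
  (map_poly (h2 \o polyC) D).[g2] != 0 /\
  (map_poly (h2 \o polyC) N).[g2] = ev h2 r2 G * (map_poly (h2 \o polyC) D).[g2].
Proof.
move=> g1 g2 V1 D1 DG; have V2 := generic_neq0 V1.
have [n [N' DN]] := fraction_horner (polyC \o polyC) N U V.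
have [m [D' DD]] := fraction_horner (polyC \o polyC) D U V.
have := DN _ (ev h1 r1) V1; have := DD _ (ev h1 r1) V1.
have := DN _ (ev h2 r2) V2; have := DD _ (ev h2 r2) V2.
rewrite !map_ev_const -/g1 -/g2 => D2E N2E D1E N1E.
have D2 : (map_poly (h2 \o polyC) D).[g2] != 0.
  have: ev h1 r1 D' != 0 by rewrite D1E mulf_neq0 ?expf_neq0.
  by move/generic_neq0; rewrite D2E mulf_eq0 negb_or => /andP[].
have expand (M : fieldType) (x y a b c : M) :
  x * (y * a) - b * y * (x * c) = x * y * (a - b * c) by ring.
pose rel := V ^+ m * N' - G * V ^+ n * D'.
have relE (M : fieldType) (h : {rmorphism {poly F} -> M}) r : ev h r rel =
    ev h r V ^+ m * ev h r N' - ev h r G * ev h r V ^+ n * ev h r D'.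
  by rewrite /rel !(rmorphE, rmorphM).
split=> //; have: ev h2 r2 rel = 0.
  apply: (generic_transfer gp1 gp2).
  by rewrite relE N1E D1E DG expand divfK // subrr mulr0.
rewrite relE N2E D2E expand => /eqP.
by rewrite mulf_eq0 subr_eq0 mulf_eq0 !expf_eq0 (negPf V2) !andbF => /eqP.
Qed.

End Transfer.

Lemma monic_Px : Px \is monic.
Proof.
by rewrite monicE PxE lead_coefDl ?lead_coefXn // size_polyN size_polyX size_polyXn ltnS.
Qed.

Lemma monic_Dx : Dx \is monic.
Proof.
rewrite monicE DxE lead_coefDr ?lead_coefM ?lead_coefX ?mul1r -?monicE ?monic_Px //.
by rewrite mulrC size_mulX ?Px_neq0 // size_Px size_poly1.
Qed.

Lemma size_Dx2 : size (Dx ^+ 2) = (2 * q).+3.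
Proof.
rewrite expr2 size_mul ?Dx_neq0 // size_Dx; lia.
Qed.

Lemma curve_poly_size_lead :
  size curve_poly = (2 * q).+3 /\ lead_coef curve_poly = 'X^2.
Proof.
have lD : lead_coef (Dx ^+ 2) = 1 by rewrite lead_coef_exp (monicP monic_Dx) expr1n.
pose A : {poly {poly F}} := map_poly polyC (Dx ^+ 2) * 'X%:P ^+ 2.
pose B := map_poly polyC Px * 'X%:P ^+ 2
  + map_poly polyC (utrace%:P * Px * Dx) * 'X%:P + map_poly polyC (Px ^+ 2).
have DAB : curve_poly = A + B.
  by rewrite curve_poly_coefs rmorphD mulrDl /A /B !addrA.
have X2 : ('X%:P : {poly {poly F}}) ^+ 2 = ('X^2)%:P by rewrite polyC_exp.
have X2n0 : ('X^2 : {poly F}) != 0 by rewrite -size_poly_gt0 size_polyXn.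
have sAq : size A = (2 * q).+3.
  by rewrite /A X2 mulrC size_Cmul // size_map_polyC size_Dx2.
have lA : lead_coef A = 'X^2.
  rewrite /A X2 lead_coefM lead_coefC lead_coef_map_inj ?lD ?polyC1 ?mul1r //.
  exact: polyC_inj.
have sB : (size B < size A)%N.
  rewrite sAq ltnS; apply: leq_trans (size_polyD _ _) _; rewrite geq_max; apply/andP; split.
    apply: leq_trans (size_polyD _ _) _; rewrite geq_max; apply/andP; split.
      by rewrite X2 mulrC size_Cmul // size_map_polyC size_Px; lia.
    rewrite mulrC size_Cmul ?polyX_eq0 // size_map_polyC -mulrA mul_polyC.
    apply: leq_trans (size_scale_leq _ _) _.
    by rewrite size_mul ?Px_neq0 ?Dx_neq0 // size_Px size_Dx; lia.
  by rewrite size_map_polyC expr2 size_mul ?Px_neq0 // size_Px; lia.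
by rewrite DAB size_polyDl // lead_coefDl.
Qed.

(** A common factor divides the leading coefficient T^2, so it is a power of T;
    but f does not vanish at T = 0, where it is P^2. *)
Lemma curve_poly_primitive (d : {poly F}) :
  (forall i, d %| curve_poly`_i) -> size d = 1%N.
Proof.
move=> dvd_d; have := dvd_d (size curve_poly).-1.
rewrite -lead_coefE curve_poly_size_lead.2 -['X]subr0.
case/dvdp_exp_XsubCP => -[|k] _ Dd; first by rewrite (eqp_size Dd) expr0 size_poly1.
suff: Px ^+ 2 = 0 by move/eqP; rewrite expf_eq0 (negPf Px_neq0).
have <- : map_poly (horner_eval 0) curve_poly = Px ^+ 2.
  rewrite curve_polyE rmorph_curve_eq /= map_polyX !map_polyC /= /horner_eval hornerC hornerX.
  rewrite /curve_eq PxE; ring.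
apply/polyP => i; rewrite coef_map coef0 /= /horner_eval; apply/eqP.
have: ('X - 0%:P) %| curve_poly`_i.
  by apply: dvdp_trans (dvd_d i); rewrite (eqp_dvdr _ Dd) polyC0; apply: dvdp_exp.
by rewrite dvdp_XsubCl.
Qed.

Lemma deg_curve_poly : deg_x curve_poly = (2 * q.+1)%N /\ deg_T curve_poly = 2.
Proof.
rewrite /deg_x /deg_T sizeYE swapXY_curve_poly_size_lead.1 curve_poly_size_lead.1.
by split=> //=; lia.
Qed.

End Curve.

(** * The points with values in F((T)) *)

Section LaurentPoints.
Variables (F : finFieldType) (u : F).
Hypotheses (q_gt1 : (1 < #|F|)%N) (u_neq0 : u != 0) (u2_neq1 : u ^+ 2 != 1).
Local Notation q := #|F|.

Lemma expf_card_prod (R : comNzRingType) (j : {rmorphism F -> R}) (x : R) :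
  x ^+ q - x = \prod_(c : F) (x - j c).
Proof.
have /(congr1 (fun p => (map_poly j p).[x])) := finField_genPoly F.
rewrite rmorphB rmorphXn /= map_polyX rmorph_prod horner_prod.
rewrite hornerD hornerN hornerXn hornerX => ->.
by apply: eq_bigr => c _; rewrite rmorphB /= map_polyX map_polyC hornerXsubC.
Qed.

(** x^q - x is the product of the x - c, which a translation by an element of F
    permutes. *)
Lemma expf_card_translate (R : comNzRingType) (j : {rmorphism F -> R}) (a : F) (h : R) :
  (j a + h) ^+ q - (j a + h) = h ^+ q - h.
Proof.
rewrite !(expf_card_prod j) [RHS](reindex_inj (@addIr _ (- a))) /=.
by apply: eq_bigr => c _; rewrite rmorphB; ring.
Qed.

(** The roots of z^2 - (u + u^-1) z + 1. *)
Definition root_residue (b : bool) : F := if b then u else u^-1.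

Lemma root_residue_inj : injective root_residue.
Proof.
have uu : u <> u^-1 by move=> e; case/eqP: u2_neq1; rewrite expr2 {2}e mulfV.
by case=> [] [] //= e; case: uu.
Qed.

Lemma root_residue_neq0 b : root_residue b != 0.
Proof. by case: b; rewrite /= ?invr_eq0. Qed.

Lemma hensel_quadratic (p : {poly powser F}) b :
    map_poly (@ps0 F) p = 'X ^+ 2 - (utrace u)%:P * 'X + 1 ->
  exists2 z, ps0 z = root_residue b & p.[z] = 0.
Proof.
move=> Dp; have d0 := u_subV_neq0 u_neq0 u2_neq1.
apply: hensel; rewrite Dp.
  rewrite rootE !hornerE; apply/eqP; rewrite utraceE.
  by case: b => /=; field.
rewrite derivD derivC derivB derivXn /= mul_polyC derivZ derivX.
rewrite rootE !hornerE utraceE; case: b => /=.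
  by apply: contra d0 => /eqP e; rewrite -e; apply/eqP; ring.
by apply: contra d0 => /eqP e; rewrite -oppr_eq0 -e; apply/eqP; ring.
Qed.

Local Notation T := (@psT F).
Local Notation tofrac := (@FracField.tofrac _).

(** At x = a + T z one has P = - T W(z) with W(z) = z - T^(q-1) z^q, and
    f = T^2 p(z) where p reduces to z^2 - (u + u^-1) z + 1 modulo T. *)
Lemma finite_point (a : F) b : exists2 z, ps0 z = root_residue b &
  curve_eq q (psC (utrace u)) T (psC a + T * z) = 0.
Proof.
have [k qk] : exists k, q = k.+2 by exists q.-2; case: q q_gt1 => [|[]].
pose W : {poly powser F} := 'X - (T ^+ k.+1)%:P * 'X^q.
pose D : {poly powser F} := 1 - T%:P * (((psC a)%:P + T%:P * 'X) * W).
pose p := D ^+ 2 - T%:P * W - (psC (utrace u))%:P * W * D + W ^+ 2.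
have [|z z0 pz] := @hensel_quadratic p b.
  have mW : map_poly (@ps0 F) W = 'X.
    rewrite /W !(rmorphE, rmorphM) /= !map_polyX map_polyC /=.
    by rewrite ps0T expr0n /= mul0r subr0.
  have mT : map_poly (@ps0 F) T%:P = 0 by rewrite map_polyC /= ps0T.
  have mD : map_poly (@ps0 F) D = 1.
    by rewrite /D rmorphB rmorph1 rmorphM /= mT mul0r subr0.
  rewrite /p; clear p; clearbody D; clearbody W.
  rewrite !(rmorphE, rmorphM) /= mW mD mT map_polyC /= psCK; ring.
exists z => //.
have Pz : (psC a + T * z) ^+ q - (psC a + T * z) = - T * (z - T ^+ k.+1 * z ^+ q).
  rewrite expf_card_translate exprMn {1}qk exprS; ring.
rewrite /curve_eq Pz.
have <- : T ^+ 2 * p.[z] = 0 by rewrite pz mulr0.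
rewrite /p /D /W !(hornerD, hornerN, hornerM, hornerC, hornerX, horner_exp).
ring.
Qed.

(** The equation in the coordinate at infinity: for q = k + 2, multiplication by
    x^(q+1) turns P(x^-1) into x - x^q and D(x^-1) into 1 + x^(q+1) - x^(q-1).
    The hypothesis has P for x^q - x, whence its signs. *)
Lemma curve_eq_inv (M : fieldType) k (b t x : M) : x != 0 ->
    let P := x ^+ k.+2 - x in let D := 1 + x ^+ k.+3 - x ^+ k.+1 in
    (D ^+ 2 - x ^+ k.+3 * P) * t ^+ 2 - b * P * D * t + P ^+ 2 = 0 ->
  curve_eq k.+2 b t x^-1 = 0.
Proof.
move=> x_neq0 /=; rewrite /curve_eq exprVn (exprS x k.+2) !(exprS x k.+1).
have := expf_neq0 k.+1 x_neq0; move: (x ^+ k.+1) => y y_neq0 e.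
apply: (mulfI (expf_neq0 2 (mulf_neq0 (expf_neq0 2 x_neq0) y_neq0))).
by rewrite mulr0 -[RHS]e; field; rewrite x_neq0 y_neq0.
Qed.

(** The analogue of [finite_point] in the coordinate s = x^-1 = - T z; the sign
    makes the reduction modulo T the same quadratic polynomial. *)
Lemma infinite_point b : exists2 z, ps0 z = root_residue b &
  curve_eq q (tofrac (psC (utrace u))) (tofrac T) (tofrac (- T * z))^-1 = 0.
Proof.
have [k qk] : exists k, q = k.+2 by exists q.-2; case: q q_gt1 => [|[]].
pose S : {poly powser F} := - T%:P * 'X.
pose W : {poly powser F} := 'X - (- T)%:P ^+ k.+1 * 'X^q.
pose D : {poly powser F} := 1 + S ^+ k.+3 - S ^+ k.+1.
pose p := D ^+ 2 - T%:P * S ^+ k.+3 * W + (psC (utrace u))%:P * - W * D + W ^+ 2.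
have [|z z0 pz] := @hensel_quadratic p b.
  have mT : map_poly (@ps0 F) T%:P = 0 by rewrite map_polyC /= ps0T.
  have mW : map_poly (@ps0 F) W = 'X.
    rewrite /W !(rmorphE, rmorphM) /= map_polyX mT.
    by rewrite oppr0 expr0n /= mul0r subr0.
  have mS : map_poly (@ps0 F) S = 0.
    by rewrite /S rmorphM rmorphN /= mT oppr0 mul0r.
  have mD : map_poly (@ps0 F) D = 1.
    rewrite /D; clear p D; clearbody S.
    by rewrite !(rmorphE, rmorphM) /= mS !expr0n /= subr0 addr0.
  rewrite /p; clear p; clearbody D; clearbody W; clearbody S.
  rewrite !(rmorphE, rmorphM) /= mW mD mT map_polyC /= psCK; ring.
exists z => //.
have s_neq0 : - T * z != 0.
  rewrite mulf_neq0 ?oppr_eq0 ?psT_neq0 //.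
  by apply: contraNneq (root_residue_neq0 b) => zz; rewrite -z0 zz rmorph0.
have: tofrac (T ^+ 2 * p.[z]) = 0 by rewrite pz mulr0 rmorph0.
set s := - T * z in s_neq0 *.
have Ds : S.[z] = s by rewrite /S !(hornerM, hornerN, hornerC, hornerX).
have DW : T * W.[z] = s ^+ k.+2 - s.
  rewrite /W !(hornerD, hornerN, hornerM, hornerC, hornerX, horner_exp) /s qk exprMn.
  by rewrite [(- T) ^+ k.+2]exprS; move: ((- T) ^+ k.+1) (z ^+ k.+2) => A B; ring.
have DD : D.[z] = 1 + s ^+ k.+3 - s ^+ k.+1.
  by rewrite /D !(hornerD, hornerN, hornerC, horner_exp) Ds.
have -> : T ^+ 2 * p.[z] = (D.[z] ^+ 2 - s ^+ k.+3 * (T * W.[z])) * T ^+ 2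
   - psC (utrace u) * (T * W.[z]) * D.[z] * T + (T * W.[z]) ^+ 2.
  rewrite /p; clear p pz; clearbody D; clearbody W; clearbody S.
  by rewrite !(horner_exp, hornerD, hornerN, hornerM, hornerC, hornerX) Ds; ring.
rewrite {}DW {}DD; clear Ds; clearbody s.
move: (psC (utrace u)) s_neq0 => beta; rewrite -tofrac_eq0 => s_neq0.
by rewrite !(rmorphE, rmorphM) /= qk => e; apply: curve_eq_inv.
Qed.

(** The reduction of x modulo T, in the projective line over F, with None for
    infinity, together with the residue of z, that is, the choice between the
    two points above it. *)
Definition located (i : option F * bool) (x : laurent F) : Prop :=
  exists2 z, ps0 z = root_residue i.2 &
    x = if i.1 is Some a then tofrac (psC a + T * z) else (tofrac (- T * z))^-1.

Lemma tofrac_inj (R : idomainType) : injective (@FracField.tofrac R).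
Proof. by move=> x y /eqP; rewrite tofrac_eq => /eqP. Qed.

Lemma located_inj i j x : located i x -> located j x -> i = j.
Proof.
have nz z b : ps0 z = root_residue b -> - T * z != 0.
  move=> z0; rewrite mulf_neq0 ?oppr_eq0 ?psT_neq0 //.
  by apply: contraNneq (root_residue_neq0 b) => zz; rewrite -z0 zz rmorph0.
have mixed y z b : ps0 z = root_residue b -> tofrac y <> (tofrac (- T * z))^-1.
  move/nz => s_neq0 e; have : - T * z * y = 1.
    by apply: tofrac_inj; rewrite rmorphM /= e rmorph1 mulfV // tofrac_eq0.
  move/(congr1 ps0)/eqP.
  by rewrite !rmorphM rmorphN /= ps0T oppr0 !mul0r rmorph1 eq_sym oner_eq0.
have key b1 b2 z1 z2 : ps0 z1 = root_residue b1 -> ps0 z2 = root_residue b2 ->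
    T * z1 = T * z2 -> b1 = b2.
  by move=> z1b z2b /(mulfI (psT_neq0 F)) z12; apply: root_residue_inj; rewrite -z1b z12.
case: i j => [[a|] b] [[a'|] b'] [z /= z0 ->] [z' /= z0' e]; first 1 last.
- by case: (mixed _ _ _ z0' e).
- by case: (mixed _ _ _ z0 (esym e)).
- move/invr_inj/tofrac_inj: e; rewrite !mulNr => /oppr_inj e.
  by rewrite (key _ _ _ _ z0 z0' e).
move/tofrac_inj: e => e; have /(congr1 ps0) := e.
rewrite !rmorphD !rmorphM /= !psCK ps0T !mul0r !addr0 => aa'; rewrite aa' in e *.
by rewrite (key _ _ _ _ z0 z0' (@addrI _ _ _ _ e)).
Qed.

HB.instance Definition _ := GRing.RMorphism.copy (@laurent_of_poly F)
  (@FracField.tofrac (powser F) \o @powser_of_poly F).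

Lemma laurent_of_poly_inj : injective (@laurent_of_poly F).
Proof. exact: inj_comp (@tofrac_inj _) (@powser_of_poly_inj F). Qed.

(** One point for each rational point of the projective line and each of the two
    residues; [located] tells them apart. *)
Theorem laurent_points : exists rho : option F * bool -> laurent F,
  injective rho /\ forall i, generic_point q u (@laurent_of_poly F) (rho i).
Proof.
have /choice[rho rhoP] : forall i, exists x : laurent F,
    located i x /\ generic_point q u (@laurent_of_poly F) x.
  case=> [[a|] b].
    have [z z0 Dz] := finite_point a b; exists (tofrac (psC a + T * z)).
    split; first by exists z.
    split; first exact: laurent_of_poly_inj.
    by rewrite ev_curve_poly -[RHS](rmorph0 tofrac) -Dz rmorph_curve_eq.
  have [z z0 Dz] := infinite_point b; exists (tofrac (- T * z))^-1.
  split; first by exists z.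
  by split; [apply: laurent_of_poly_inj | rewrite ev_curve_poly].
exists rho; split=> [i j e|i]; last by case: (rhoP i).
by apply: located_inj (rhoP i).1 _; rewrite e; case: (rhoP j).
Qed.

Lemma laurent_splits :
  splits_completely (map_poly (@laurent_of_poly F) (curve_poly q u)).
Proof.
have [rho [rho_inj rhoP]] := laurent_points.
exists (codom rho); apply: all_roots_prod_XsubC.
- rewrite size_map_inj_poly ?rmorph0 //; last exact: laurent_of_poly_inj.
  rewrite (curve_poly_size_lead q_gt1 u_neq0 u2_neq1).1 size_codom.
  by rewrite card_prod card_option card_bool muln2 mul2n doubleS.
- by apply/allP => x /codomP[i ->]; rewrite rootE; have [_] := rhoP i => /eqP.
by rewrite uniq_rootsE; apply/injectiveP.
Qed.

End LaurentPoints.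

(** * Values of a rational parameter *)

Section Fractions.
Import FracField.

Lemma frac_div (R : idomainType) (x : {fraction R}) : exists n d,
  d != 0 /\ x = tofrac n / tofrac d.
Proof.
elim/quotW: x => -[[n d] /= d_neq0]; exists n, d; split=> //.
have dF : tofrac d != 0 by rewrite tofrac_eq0.
apply: (mulIf dF); rewrite mulfVK //.
rewrite -[LHS]/(FracField.mul _ _) !piE; apply/eqmodP; rewrite /= equivfE.
by rewrite !numden_Ratio ?mulr1 ?oner_neq0 //= mulrC.
Qed.

End Fractions.

Section RationalParameter.
Variable F : finFieldType.
Local Notation T := (@psT F).
Local Notation tofrac := (@FracField.tofrac (powser F)).

(** The residue of z is a zero of N and not of M, and a simple one because the
    value N(z) / M(z) = T has valuation 1.  It is then a simple root of the
    reduction of N - T M, and such a root lifts uniquely. *)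
Lemma simple_zero_unique (N M : {poly F}) (z z' : powser F) :
    coprimep N M -> ps0 z = ps0 z' ->
    (map_poly psC N).[z] = T * (map_poly psC M).[z] ->
    (map_poly psC N).[z'] = T * (map_poly psC M).[z'] ->
  z = z'.
Proof.
move=> co_NM zz' ez ez'.
pose p : {poly powser F} := map_poly psC N - T *: map_poly psC M.
have red (P : {poly F}) y : ps0 (map_poly psC P).[y] = P.[ps0 y].
  by rewrite -horner_map -map_poly_comp map_poly_id //= => c _; rewrite /= psCK.
have Nz0 : root N (ps0 z) by rewrite rootE -red ez rmorphM /= ps0T mul0r.
have Mz0 : M.[ps0 z] != 0 by apply: coprimep_root co_NM Nz0.
have /factor_theorem[N1 DN] := Nz0.
have [y Dy] : exists y, z - psC (ps0 z) = T * y.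
  by apply: psT_dvdP; rewrite rmorphB /= psCK subrr.
have N1z0 : N1.[ps0 z] != 0.
  have: y * (map_poly psC N1).[z] = (map_poly psC M).[z].
    apply: (mulfI (psT_neq0 F)); rewrite -ez DN rmorphM hornerM /=.
    by rewrite rmorphB /= map_polyX map_polyC hornerXsubC Dy; ring.
  move/(congr1 ps0); rewrite rmorphM /= !red => e.
  by apply: contraNneq Mz0 => N10; rewrite -e N10 mulr0.
have Dp : map_poly ps0 p = N.
  rewrite /p rmorphB /= map_polyZ /= ps0T scale0r subr0 -map_poly_comp map_poly_id //.
  by move=> c _; rewrite /= psCK.
apply: (@hensel_unique _ p) => //.
- rewrite Dp rootE DN derivM derivXsubC mulr1 hornerD hornerM hornerXsubC.
  by rewrite subrr mulr0 add0r.
- by rewrite /p hornerD hornerN hornerZ ez subrr.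
by rewrite /p hornerD hornerN hornerZ ez' subrr.
Qed.

Definition ps_integral (y : laurent F) : bool := `[< exists z, y = tofrac z >].

Lemma ps_integral_or_inv (y : laurent F) : ps_integral y || ps_integral y^-1.
Proof.
have [n [d [d_neq0 ->]]] := frac_div y.
have [n0|n_neq0] := eqVneq n 0.
  by apply/orP; left; apply/asboolP; exists 0; rewrite n0 rmorph0 mul0r.
have [[h Dh]|[h Dh]] := ps_total_dvd n d; apply/orP; [left|right]; apply/asboolP; exists h.
  by rewrite Dh rmorphM /= mulrC mulKf // tofrac_eq0.
by rewrite invf_div Dh rmorphM /= mulrC mulKf // tofrac_eq0.
Qed.

Local Notation j := (@laurent_of_poly F \o polyC).

(** Distinct integral values of g at which N(g) / M(g) = T have distinct
    residues in F. *)
Lemma parameter_integral_bound (I : finType) (g : I -> laurent F) (N M : {poly F}) :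
    injective g ->
    (forall i, (map_poly j M).[g i] != 0 /\
       (map_poly j N).[g i] = laurent_of_poly 'X * (map_poly j M).[g i]) ->
  (#|[set i | ps_integral (g i)]| <= #|F|)%N.
Proof.
move=> g_inj gNM.
have [i0 _|noI] := pickP (fun i : I => ps_integral (g i)); last first.
  rewrite (_ : [set i | _] = finset.set0) ?cards0 //.
  by apply/setP => i; rewrite finset.in_set finset.in_set0 noI.
have M_neq0 : M != 0.
  by have [+ _] := gNM i0; apply: contraNneq => ->; rewrite rmorph0 horner0.
pose d := gcdp N M.
have NM : (N != 0) || (M != 0) by rewrite M_neq0 orbT.
have co := coprimep_div_gcd NM.
have := divpK (dvdp_gcdr N M); have := divpK (dvdp_gcdl N M).
move: (N %/ _) (M %/ _) co => N1 M1 co; rewrite -/d => DN DM.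
have gN1M1 i : (map_poly j N1).[g i] = laurent_of_poly 'X * (map_poly j M1).[g i].
  have [Mi] := gNM i; rewrite -DN -DM !rmorphM !hornerM mulrA => /mulIf; apply.
  by apply: contraNneq Mi => d0; rewrite -DM rmorphM hornerM /= d0 mulr0.
have /choice[z Dz] : forall i, exists z, ps_integral (g i) -> g i = tofrac z.
  move=> i; have [/asboolP[z ->]|_] := boolP (ps_integral (g i)); first by exists z.
  by exists 0.
have red (P : {poly F}) y : (map_poly j P).[tofrac y] = tofrac (map_poly psC P).[y].
  by rewrite -horner_map -map_poly_comp.
rewrite -(@card_in_imset _ _ (fun i => ps0 (z i))) ?max_card // => i i'.
rewrite !finset.in_set => /Dz gi /Dz gi' zz'; apply: g_inj; rewrite gi gi'; congr tofrac.
apply: (simple_zero_unique co zz'); apply: tofrac_inj; rewrite rmorphM /= -!red.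
  by rewrite -gi gN1M1.
by rewrite -gi' gN1M1.
Qed.

End RationalParameter.

(** * Subfields and quadratic extensions *)

Section Subfields.
Variable L : fieldType.
Implicit Types (A E K : set L) (x y : L).

Lemma subfield0 K : is_subfield K -> K 0.
Proof. by case=> K1 KB _; rewrite -(subrr 1); apply: KB. Qed.

Lemma subfieldN K x : is_subfield K -> K x -> K (- x).
Proof. by move=> fK Kx; have [_ KB _] := fK; rewrite -sub0r; apply: KB (subfield0 fK) Kx. Qed.

Lemma subfieldD K x y : is_subfield K -> K x -> K y -> K (x + y).
Proof.
move=> fK Kx Ky; have [_ KB _] := fK.
by rewrite -[y]opprK; apply: KB Kx (subfieldN fK Ky).
Qed.

Lemma subfieldV K x : is_subfield K -> K x -> K x^-1.
Proof. by case=> K1 _ KV Kx; rewrite -div1r; apply: KV K1 Kx. Qed.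

Lemma subfieldM K x y : is_subfield K -> K x -> K y -> K (x * y).
Proof.
move=> fK Kx Ky; have [_ _ KV] := fK.
by rewrite -[y]invrK; apply: KV Kx (subfieldV fK Ky).
Qed.

Lemma subfield_horner (F : fieldType) (j : {rmorphism F -> L}) K x (p : {poly F}) :
  is_subfield K -> (forall c, K (j c)) -> K x -> K (map_poly j p).[x].
Proof.
move=> fK Kj Kx; elim/poly_ind: p => [|p c IHp].
  by rewrite rmorph0 horner0; apply: subfield0.
rewrite rmorphD rmorphM /= map_polyX map_polyC hornerMXaddC.
exact: subfieldD fK (subfieldM fK IHp Kx) (Kj c).
Qed.

Lemma generated_subfieldP A : is_subfield (generated_subfield A).
Proof.
split=> [K [K1 _ _] _ //|x y Ax Ay K fK AK|x y Ax Ay K fK AK].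
  by have [_ KB _] := fK; apply: KB; [apply: Ax | apply: Ay].
by have [_ _ KV] := fK; apply: KV; [apply: Ax | apply: Ay].
Qed.

Lemma sub_generated A x : A x -> generated_subfield A x.
Proof. by move=> Ax K _; apply. Qed.

Lemma generated_min A K x :
  is_subfield K -> (A `<=` K)%classic -> generated_subfield A x -> K x.
Proof. by move=> fK AK; apply. Qed.

Lemma fractions_subfield (R : comNzRingType) (e : {rmorphism R -> L}) :
  is_subfield [set x | exists U V, e V != 0 /\ x = e U / e V]%classic.
Proof.
split.
- by exists 1, 1; rewrite rmorph1 oner_neq0 divr1.
- move=> _ _ [U [V [V0 ->]]] [U' [V' [V0' ->]]].
  exists (U * V' - U' * V), (V * V'); rewrite !(rmorphE, rmorphM) mulf_neq0 //.
  by split=> //; field; rewrite V0 V0'.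
move=> _ _ [U [V [V0 ->]]] [U' [V' [V0' ->]]].
have [U0|U0] := eqVneq (e U') 0.
  by exists 0, 1; rewrite U0 rmorph0 rmorph1 oner_neq0 !mul0r invr0 mulr0.
exists (U * V'), (V * U'); rewrite !rmorphM mulf_neq0 //.
by split=> //; field; rewrite V0 V0' U0.
Qed.

Lemma quadratic_subfield E t p s : is_subfield E -> ~ E t ->
    E p -> E s -> t ^+ 2 = p * t + s ->
  is_subfield [set x | exists c0 c1, [/\ E c0, E c1 & x = c0 + c1 * t]]%classic.
Proof.
move=> fE tE Ep Es Dt; have [E1 EB EV] := fE; have E0 := subfield0 fE.
pose K x := exists c0 c1, [/\ E c0, E c1 & x = c0 + c1 * t].
have KM x y : K x -> K y -> K (x * y).
  move=> [a0 [a1 [Ea0 Ea1 ->]]] [b0 [b1 [Eb0 Eb1 ->]]].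
  exists (a0 * b0 + a1 * b1 * s), (a0 * b1 + a1 * b0 + a1 * b1 * p).
  split; last first.
    transitivity (a0 * b0 + (a0 * b1 + a1 * b0) * t + a1 * b1 * t ^+ 2); first by ring.
    by rewrite Dt; ring.
  by do !(apply: subfieldD || apply: subfieldM).
  by do !(apply: subfieldD || apply: subfieldM).
have KV x : K x -> K x^-1.
  move=> [a0 [a1 [Ea0 Ea1 Dx]]].
  have [->|x_neq0] := eqVneq x 0.
    by exists 0, 0; rewrite invr0 mul0r addr0.
  (* y is the conjugate of x, and n its norm. *)
  pose y := a0 + a1 * p - a1 * t; pose n := a0 ^+ 2 + a0 * a1 * p - a1 ^+ 2 * s.
  have Dn : x * y = n.
    rewrite Dx /y /n.
    transitivity (a0 ^+ 2 + a0 * a1 * p + a1 ^+ 2 * (p * t - t ^+ 2)); first by ring.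
    by rewrite Dt; ring.
  have y_neq0 : y != 0.
    apply/eqP => y0; have [a10|a1_neq0] := eqVneq a1 0.
      by case/eqP: x_neq0; rewrite Dx -y0 /y a10; ring.
    apply: tE; have -> : t = (a0 + a1 * p) / a1.
      apply: (mulIf a1_neq0); rewrite mulfVK //; apply/eqP; rewrite -subr_eq0.
      by rewrite -oppr_eq0 -y0 /y; apply/eqP; ring.
    by apply: EV => //; apply: subfieldD => //; apply: subfieldM.
  have En : E n.
    apply: EB; last by do !apply: subfieldM.
    by apply: subfieldD => //; do !apply: subfieldM.
  have n_neq0 : n != 0 by rewrite -Dn mulf_neq0.
  exists ((a0 + a1 * p) / n), (- a1 / n); split.
  - by apply: EV => //; apply: subfieldD => //; apply: subfieldM.
  - by apply: EV => //; apply: subfieldN.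
  by apply: (mulfI x_neq0); rewrite mulfV // -[LHS](mulfV n_neq0) -{1}Dn /y; ring.
split.
- by exists 1, 0; rewrite mul0r addr0.
- move=> _ _ [a0 [a1 [Ea0 Ea1 ->]]] [b0 [b1 [Eb0 Eb1 ->]]].
  exists (a0 - b0), (a1 - b1); split; [exact: EB | exact: EB | ring].
by move=> x y Kx Ky; apply: KM => //; apply: KV.
Qed.

Lemma quadratic_has_degree E K t : is_subfield E -> ~ E t -> K 1 -> K t ->
    (forall x, K x -> exists c0 c1, [/\ E c0, E c1 & x = c0 + c1 * t]) ->
  has_degree K E 2.
Proof.
move=> fE tE K1 Kt KE; pose v (a b : L) : 'rV[L]_2 := \row_i (if i == 0 then a else b).
have sumv c : \sum_i c 0 i * v 1 t 0 i = c 0 0 + c 0 1 * t.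
  by rewrite !big_ord_recl big_ord0 addr0 !mxE /= mulr1; congr (_ + c 0 _ * _); apply: val_inj.
exists (v 1 t) => [i|x Kx]; first by rewrite mxE; case: ifP.
have [c0 [c1 [Ec0 Ec1 Dx]]] := KE x Kx.
exists (v c0 c1); split=> [|c [Ec]].
  split; first by move=> i; rewrite mxE; case: ifP.
  by rewrite sumv !mxE.
rewrite sumv Dx => e.
have e1 : c1 = c 0 1.
  apply/eqP; rewrite -subr_eq0; apply/negPn/negP => d_neq0; apply: tE.
  have -> : t = (c 0 0 - c0) / (c1 - c 0 1).
    apply: (mulIf d_neq0); rewrite mulfVK //; apply/eqP; rewrite -subr_eq0.
    by move/eqP: e; rewrite -subr_eq0 => /eqP e; apply/eqP; rewrite -[RHS]e; ring.
  have [_ EB EV] := fE; apply: EV; apply: EB => //.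
apply/rowP => i; rewrite mxE; case: eqP => [->|/eqP i0].
  by move: e; rewrite e1 => /addIr.
rewrite e1; congr (c 0 _); apply: val_inj.
by case: i i0 => [[|[|]]].
Qed.

End Subfields.

(** * The function field *)

Lemma clear_denominators (R : idomainType) (p : {poly {fraction R}}) :
  exists d G, d != 0 /\ map_poly (@FracField.tofrac R) G = FracField.tofrac d *: p.
Proof.
elim/poly_ind: p => [|p c [d [G [d_neq0 DG]]]].
  by exists 1, 0; rewrite oner_neq0 rmorph0 scaler0.
have [n [d' [d'_neq0 ->]]] := frac_div c.
exists (d * d'), (G * d'%:P * 'X + (d * n)%:P); rewrite mulf_neq0 //; split=> //.
have d'F : FracField.tofrac d' != 0 by rewrite tofrac_eq0.
rewrite rmorphD !rmorphM /= map_polyX !map_polyC /= DG scalerDr; congr (_ + _).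
  by rewrite -!mul_polyC polyCM; ring.
by rewrite -mul_polyC -!polyCM -mulrA [FracField.tofrac d' * _]mulrC divfK.
Qed.

Section FunctionField.
Variables (F : fieldType) (q : nat) (u : F).
Hypotheses (q_gt1 : (1 < q)%N) (u_neq0 : u != 0) (u2_neq1 : u ^+ 2 != 1).
Local Notation f := (curve_poly q u).
Variables (Kbar : fieldType) (iota : {rmorphism ratfun F -> Kbar}).

Definition iotaT : {poly F} -> Kbar := iota \o @FracField.tofrac {poly F}.
HB.instance Definition _ := GRing.RMorphism.copy iotaT
  (iota \o @FracField.tofrac {poly F}).

Lemma iotaT_inj : injective iotaT.
Proof. by apply: inj_comp (@tofrac_inj _); apply: fmorph_inj. Qed.

Lemma map_curve_poly_iotaT :
  map_poly iotaT f = map_poly iota (map_poly (@FracField.tofrac _) f).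
Proof. by rewrite -map_poly_comp. Qed.

Lemma size_map_tofrac (p : {poly {poly F}}) :
  size (map_poly (@FracField.tofrac {poly F}) p) = size p.
Proof. by rewrite size_map_inj_poly ?rmorph0 //; apply: tofrac_inj. Qed.

Variable alpha : Kbar.

Local Notation K := (generated_subfield (range iota `|` [set alpha])%classic).
Local Notation Kx g := (generated_subfield (range (const_emb iota) `|` [set g])%classic).
Local Notation j := (iotaT \o polyC).

Lemma iotaT_in_K p : K (iotaT p).
Proof. by apply: sub_generated; left; exists (FracField.tofrac p). Qed.

Lemma K_fraction x : K x -> exists U V, ev iotaT alpha V != 0 /\
  x = ev iotaT alpha U / ev iotaT alpha V.
Proof.
move=> Kx; have fS := @fractions_subfield Kbar {poly {poly F}} (ev iotaT alpha).
apply: (generated_min fS) Kx => {x}; move=> _ [[y _ <-]|->].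
  have [n [d [d_neq0 ->]]] := frac_div y; exists n%:P, d%:P.
  by rewrite /= !evC /= fmorph_eq0 tofrac_eq0 fmorph_div.
by exists 'X, 1; rewrite /= evX rmorph1 oner_neq0 divr1.
Qed.

Lemma Kx_fraction g x : Kx g x -> exists N D, (map_poly j D).[g] != 0 /\
  x = (map_poly j N).[g] / (map_poly j D).[g].
Proof.
move=> Kx; have fS := @fractions_subfield Kbar {poly F} (horner_eval g \o map_poly j).
apply: (generated_min fS) Kx => {x}.
move=> _ [[c _ <-]|->].
  exists c%:P, 1; rewrite /= /horner_eval rmorph1 map_polyC !hornerC.
  by rewrite oner_neq0 divr1.
exists 'X, 1; rewrite /= /horner_eval rmorph1 map_polyX hornerX hornerC.
by rewrite oner_neq0 divr1.
Qed.

Hypothesis gp : generic_point q u iotaT alpha.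

(** The function x itself, with basis 1, T over F(x). *)
Lemma degree2_map : has_map_to_P1 iota K 2.
Proof.
have fE := generated_subfieldP (range (const_emb iota) `|` [set alpha])%classic.
have fK := generated_subfieldP (range iota `|` [set alpha])%classic.
have Ealpha : Kx alpha alpha by apply: sub_generated; right.
have Ec c : Kx alpha (j c) by apply: sub_generated; left; exists c.
have evxE p : Kx alpha (ev iotaT alpha (map_poly polyC p)).
  by rewrite evP; apply: (subfield_horner (j := j) p fE Ec Ealpha).
have ET : ~ Kx alpha (iotaT 'X).
  move=> /Kx_fraction[N [D [D0 DT]]]; move: (D0); rewrite -evP => /eqP[].
  have [|-> _] := @T_not_rational F q u q_gt1 u_neq0 u2_neq1 _ _ _ gp D (- N).
    by rewrite /= DT !evP rmorphN hornerN mulrC divfK ?subrr.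
  by rewrite !rmorph0.
exists alpha; split; first by apply: sub_generated; right.
  exact: (generic_transcendental gp).
apply: (@quadratic_has_degree _ _ _ (iotaT 'X)) => //.
- by have [] := fK.
- exact: iotaT_in_K.
set A := ev iotaT alpha (map_poly polyC (Dx F q ^+ 2 + Px F q)).
set B := ev iotaT alpha (map_poly polyC ((utrace u)%:P * Px F q * Dx F q)).
set C := ev iotaT alpha (map_poly polyC (Px F q ^+ 2)).
have A0 : A != 0.
  apply/eqP => /(ev_inj_x gp)/eqP.
  by rewrite (negPf (lead_curve_neq0 q_gt1 u_neq0 u2_neq1)).
have eABC : A * iotaT 'X ^+ 2 + B * iotaT 'X + C = 0.
  by rewrite -gp.2 ev_curve_poly_coefs.
have [E1 _ EV] := fE; have E0 := subfield0 fE.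
have EA P : Kx alpha (- ev iotaT alpha (map_poly polyC P) / A).
  exact: EV (subfieldN fE (evxE P)) (evxE _).
have DT : iotaT 'X ^+ 2 = - B / A * iotaT 'X + - C / A.
  apply: (mulfI A0); apply/eqP; rewrite -subr_eq0 -[X in _ == X]eABC; apply/eqP.
  clear eABC EA; move: B C (iotaT 'X) => b c t; clearbody A.
  by field.
have fS := quadratic_subfield fE ET (EA _) (EA _) DT.
have ES x : Kx alpha x ->
    exists c0 c1, [/\ Kx alpha c0, Kx alpha c1 & x = c0 + c1 * iotaT 'X].
  by move=> Ex; exists x, 0; rewrite mul0r addr0.
have TS p : exists c0 c1, [/\ Kx alpha c0, Kx alpha c1 & iotaT p = c0 + c1 * iotaT 'X].
  rewrite -horner_constX; apply: (subfield_horner (j := j) p fS) => [c|].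
    exact: ES (Ec c).
  by exists 0, 1; rewrite mul1r add0r.
move=> x; apply: (generated_min fS) => _ [[y _ <-]|->]; last exact: ES Ealpha.
have [n [d [d_neq0 ->]]] := frac_div y; rewrite fmorph_div.
by have [_ _ SV] := fS; apply: (SV _ _ (TS n) (TS d)).
Qed.

End FunctionField.

(** * Irreducibility and gonality *)

Section Gonality.
Variables (F : finFieldType) (u : F).
Hypotheses (q_gt1 : (1 < #|F|)%N) (u_neq0 : u != 0) (u2_neq1 : u ^+ 2 != 1).
Local Notation q := #|F|.
Local Notation f := (curve_poly q u).
Local Notation gpoint := (@generic_point F q u _).

(** A polynomial relation at one generic point holds at all the points in F((T)),
    and there are as many of these as the degree of f. *)
Lemma vanishing_size (M : fieldType) (h : {rmorphism {poly F} -> M}) r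
    (G : {poly {poly F}}) :
  gpoint h r -> ev h r G = 0 -> G != 0 -> (size f <= size G)%N.
Proof.
move=> gp G0 G_neq0; have [rho [rho_inj rhoP]] := laurent_points q_gt1 u_neq0 u2_neq1.
have := @max_poly_roots _ (map_poly (@laurent_of_poly F) G) (codom rho).
rewrite size_map_inj_poly ?rmorph0 //; last exact: laurent_of_poly_inj.
rewrite size_codom card_prod card_option card_bool (curve_poly_size_lead q_gt1 u_neq0 u2_neq1).1.
rewrite muln2 mul2n doubleS; apply.
- rewrite -size_poly_eq0 size_map_inj_poly ?rmorph0 ?size_poly_eq0 //.
  exact: laurent_of_poly_inj.
- apply/allP => _ /codomP[i ->]; apply/eqP.
  exact: (generic_transfer q_gt1 u_neq0 u2_neq1 gp (rhoP i)).
by apply/injectiveP.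
Qed.

(** If x and T are rational functions of g = U / V, then the values of g at the
    points in F((T)) are distinct, since they determine those of x, and
    [parameter_integral_bound] applies to them. *)
Lemma no_rational_parameter (M : fieldType) (h : {rmorphism {poly F} -> M}) r
    (U V : {poly {poly F}}) (N D N' D' : {poly F}) : gpoint h r ->
    let j := h \o polyC in let g := ev h r U / ev h r V in
    ev h r V != 0 -> (map_poly j D).[g] != 0 -> (map_poly j D').[g] != 0 ->
    h 'X = (map_poly j N).[g] / (map_poly j D).[g] ->
    r = (map_poly j N').[g] / (map_poly j D').[g] ->
  forall (rho : option F * bool -> laurent F), injective rho ->
    (forall i, gpoint (@laurent_of_poly F) (rho i)) ->
  (#|[set i | ps_integral (ev (@laurent_of_poly F) (rho i) U
                             / ev (@laurent_of_poly F) (rho i) V)]| <= q)%N.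
Proof.
move=> gp j g V0 D0 D0' DT Dr rho rho_inj rhoP.
pose gi i := ev (@laurent_of_poly F) (rho i) U / ev (@laurent_of_poly F) (rho i) V.
apply: (@parameter_integral_bound _ _ gi N D).
  move=> i i' e; apply: rho_inj; rewrite -(evX (@laurent_of_poly F) (rho i)).
  rewrite -(evX (@laurent_of_poly F) (rho i')).
  have Dr' : ev h r 'X = (map_poly j N').[g] / (map_poly j D').[g] by rewrite evX.
  have [Di Ni] := transfer_parameter q_gt1 u_neq0 u2_neq1 gp (rhoP i) V0 D0' Dr'.
  have [Di' Ni'] := transfer_parameter q_gt1 u_neq0 u2_neq1 gp (rhoP i') V0 D0' Dr'.
  rewrite -/(gi i) e in Di Ni; rewrite -/(gi i') in Di' Ni'.
  by apply: (mulIf Di); rewrite -Ni -Ni'.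
move=> i; rewrite -(evC (@laurent_of_poly F) (rho i)).
by apply: (transfer_parameter q_gt1 u_neq0 u2_neq1 gp (rhoP i) V0 D0); rewrite evC.
Qed.

Section FiniteFunctionField.
Variables (Kbar : closedFieldType) (iota : {rmorphism ratfun F -> Kbar}).
Local Notation iotaT := (iotaT iota).

(** A nonconstant factor has a root in Kbar, which is a generic point; by
    [vanishing_size] the factor then has the degree of f. *)
Lemma curve_poly_irreducible : irreducible_poly (map_poly (@FracField.tofrac {poly F}) f).
Proof.
have [sf _] := curve_poly_size_lead q_gt1 u_neq0 u2_neq1.
split=> [|p p1 p_dvd]; first by rewrite size_map_tofrac sf.
have f_neq0 : map_poly (@FracField.tofrac {poly F}) f != 0.
  by rewrite -size_poly_eq0 size_map_tofrac sf.
rewrite -dvdp_size_eqp // eqn_leq dvdp_leq //= size_map_tofrac.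
have [d [G [d_neq0 DG]]] := clear_denominators p.
have size_pG : size p = size G.
  by rewrite -(size_map_tofrac G) DG size_scale // tofrac_eq0.
have /closed_rootP[r pr0] : size (map_poly iota p) != 1%N by rewrite size_map_poly.
have gp : gpoint iotaT r.
  split; first exact: iotaT_inj.
  apply/eqP; rewrite -[_ == _]/(root (map_poly iotaT f) r) map_curve_poly_iotaT.
  by apply: root_dvdp pr0; rewrite dvdp_map.
rewrite size_pG; apply: (vanishing_size gp).
  have map_G : map_poly iotaT G = map_poly iota (map_poly (@FracField.tofrac _) G).
    by rewrite -map_poly_comp.
  rewrite /ev map_G.
  by rewrite DG map_polyZ hornerZ (rootP pr0) mulr0.
apply: contraNneq f_neq0 => G0; move: p_dvd; rewrite -size_poly_eq0.
have -> : p = 0 by apply/eqP; rewrite -size_poly_eq0 size_pG G0 size_poly0.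
by rewrite dvd0p => /eqP ->; rewrite size_poly0.
Qed.

Variable alpha : Kbar.
Hypothesis gp : gpoint iotaT alpha.
Local Notation K := (generated_subfield (range iota `|` [set alpha])%classic).
Local Notation Kx g := (generated_subfield (range (const_emb iota) `|` [set g])%classic).

Lemma curve_poly_minimal : is_minimal_polynomial iota alpha f.
Proof.
split; first exact: curve_poly_irreducible.
- by apply/rootP; case: gp.
- exact: (curve_poly_primitive q_gt1 u_neq0 u2_neq1).
by rewrite (curve_poly_size_lead q_gt1 u_neq0 u2_neq1).2 monicXn.
Qed.

(** A basis of one element makes the function field equal to F(g), hence also to
    F(g^-1).  At each of the 2 (q + 1) points in F((T)) the value of g or that
    of g^-1 is integral, and each of the two is integral at most q times. *)
Lemma not_rational : ~ has_map_to_P1 iota K 1.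
Proof.
case=> g [Kg g_tr [b _ basis]].
(* Both x and z are multiples of the single basis element. *)
have Kx_sub y x z : K x -> K z -> z != 0 -> y = x / z -> Kx g y.
  move=> Kx Kz z_neq0 ->.
  have [c [[Ec ex] _]] := basis x Kx; have [d [[Ed ez] _]] := basis z Kz.
  move: ex ez z_neq0; rewrite !big_ord_recl !big_ord0 !addr0 => -> ->.
  rewrite mulf_eq0 negb_or => /andP[d0 b0].
  have -> : c 0 ord0 * b 0 ord0 / (d 0 ord0 * b 0 ord0) = c 0 ord0 / d 0 ord0.
    by field; rewrite d0 b0.
  have [_ _ KV] := generated_subfieldP (range (const_emb iota) `|` [set g])%classic.
  exact: KV (Ec ord0) (Ed ord0).
have K1 : K 1 by have [] := generated_subfieldP (range iota `|` [set alpha])%classic.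
have Kx_all x : K x -> Kx g x.
  by move=> Kx'; apply: (Kx_sub x x 1) => //; rewrite ?oner_neq0 ?divr1.
have Kalpha : K alpha by apply: sub_generated; right.
have g_neq0 : g != 0.
  by apply/eqP => g0; apply: g_tr; rewrite g0; apply: (algebraic0 (iotaT \o polyC)).
have KxV x : Kx g x -> Kx g^-1 x.
  apply: generated_min; first exact: generated_subfieldP.
  move=> y [ry|->]; first by apply: sub_generated; left.
  have gV : Kx g^-1 g^-1 by apply: sub_generated; right.
  by have := subfieldV (generated_subfieldP _) gV; rewrite invrK.
have [U [V [V0 Dg]]] := K_fraction Kg.
have U0 : ev iotaT alpha U != 0 by apply: contraNneq g_neq0 => U0; rewrite Dg U0 mul0r.
have DVg : g^-1 = ev iotaT alpha V / ev iotaT alpha U by rewrite Dg invf_div.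
have [rho [rho_inj rhoP]] := laurent_points q_gt1 u_neq0 u2_neq1.
have [N [D [D0 DT]]] := Kx_fraction (Kx_all _ (iotaT_in_K 'X)).
have [N' [D' [D0' Dr]]] := Kx_fraction (Kx_all _ Kalpha).
have [P [Q [Q0 DTV]]] := Kx_fraction (KxV _ (Kx_all _ (iotaT_in_K 'X))).
have [P' [Q' [Q0' DrV]]] := Kx_fraction (KxV _ (Kx_all _ Kalpha)).
rewrite Dg in D0 DT D0' Dr; rewrite DVg in Q0 DTV Q0' DrV.
have := no_rational_parameter gp V0 D0 D0' DT Dr rho_inj rhoP.
have := no_rational_parameter gp U0 Q0 Q0' DTV DrV rho_inj rhoP.
set A := [set i | _]; set B := [set i | _] => le_A le_B.
have cover : [set: option F * bool] \subset A :|: B.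
  apply/fintype.subsetP => i _; rewrite finset.in_setU !finset.in_set -invf_div orbC.
  exact: ps_integral_or_inv.
have := leq_trans (subset_leq_card cover) (leq_card_setU A B).1.
rewrite cardsT card_prod card_option card_bool.
move/leq_trans/(_ (leq_add le_A le_B)); rewrite addnn muln2 doubleS.
by rewrite ltnNge leqW.
Qed.

Lemma curve_gonality2 : has_gonality iota alpha 2.
Proof.
split=> [|[|[|e]] //]; [exact: (degree2_map q_gt1 u_neq0 u2_neq1 gp) | | by move/not_rational].
case=> g [_ _ [b _ basis]].
have K1 : K 1 by have [] := generated_subfieldP (range iota `|` [set alpha])%classic.
have [c [[_ /eqP]]] := basis 1 K1.
by rewrite big_ord0 oner_eq0.
Qed.

End FiniteFunctionField.
End Gonality.

Lemma exists_parameter (F : finFieldType) : (3 < #|F|)%N ->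
  exists2 u : F, u != 0 & u ^+ 2 != 1.
Proof.
move=> F_gt3; have [u|noU] := pickP (predC (mem [:: 0; 1; -1 : F])).
  rewrite !inE => /norP[u0 /norP[u1 uN1]]; exists u => //.
  by rewrite sqrf_eq1 negb_or u1.
suff: (#|F| <= 3)%N by rewrite leqNgt F_gt3.
apply: leq_trans (card_size [:: 0; 1; -1 : F]).
apply: subset_leq_card; apply/fintype.subsetP => x _.
by apply/negPn; have := noU x; rewrite /= => ->.
Qed.

(** The construction works over every finite field with more than three
    elements, in any characteristic. *)
Theorem exists_small_height_gonality2 (F : finFieldType) (F_gt3 : (3 < #|F|)%N)
    (Kbar : closedFieldType) (iota : {rmorphism ratfun F -> Kbar}) :
  exists alpha : Kbar,
    [/\ totally_Tadic iota alpha,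
        has_height iota alpha (1 / (#|F| + 1)%N%:R)
      & has_gonality iota alpha 2].
Proof.
have [u u_neq0 u2_neq1] := exists_parameter F_gt3.
have q_gt1 : (1 < #|F|)%N by apply: leq_trans F_gt3.
have [sf _] := curve_poly_size_lead q_gt1 u_neq0 u2_neq1.
have /closed_rootP[alpha alpha0] : size (map_poly (iotaT iota) (curve_poly #|F| u)) != 1%N.
  by rewrite map_curve_poly_iotaT size_map_poly size_map_tofrac sf.
have gp : generic_point #|F| u (iotaT iota) alpha by split; [exact: iotaT_inj | apply/rootP].
have min_f := curve_poly_minimal q_gt1 u_neq0 u2_neq1 gp.
exists alpha; split; last exact: (curve_gonality2 q_gt1 u_neq0 u2_neq1 gp).
  by exists (curve_poly #|F| u) => //; apply: laurent_splits.
exists (curve_poly #|F| u) => //; have [-> ->] := deg_curve_poly q_gt1 u_neq0 u2_neq1.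
by rewrite natrM invfM mulrA divff // addn1.
Qed.

Theorem theorem4p9 (s : nat) (hs : (1 < s)%N)
    (F : finFieldType) (hF : #|F| = (2 ^ s)%N)
    (Kbar : closedFieldType) (iota : {rmorphism ratfun F -> Kbar})
    (hKbar : forall x : Kbar, algebraicOver iota x) :
  exists alpha : Kbar,
    [/\ totally_Tadic iota alpha,
        has_height iota alpha (1 / (2 ^ s + 1)%N%:R)
      & has_gonality iota alpha 2].
Proof.
rewrite -hF; apply: exists_small_height_gonality2.
by rewrite hF; apply: (@leq_pexp2l 2 2 s).
Qed.
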